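(* Let $(V,|0\rangle,T,Y)$ be a vertex algebra. Since $\{Y(a,z)\mid a\in V\}$ is a local family, each field $Y(b,z)$ is uniquely determined by its value on $|0\rangle$, in the following sense: if $b\in V$ and $B(z)$ is an $\mathrm{End}(V)$-valued field such that the pair $(B(z),Y(a,z))$ is local for every $a\in V$ and $B(z)|0\rangle=Y(b,z)|0\rangle$, then $B(z)=Y(b,z)$.
   Context: All vector spaces are over $\mathbb{C}$. A superspace is a $\mathbb{Z}_2$-graded space $V=V_{\bar 0}\oplus V_{\bar 1}$; for homogeneous $a,b$ put $p(a,b)=(-1)^{p(a)p(b)}$. Formulas containing $p(a,b)$ are for homogeneous elements and are extended bilinearly. An $\mathrm{End}(V)$-valued formal distribution is $a(z)=\sum_{n\in\mathbb{Z}}a_{(n)}z^{-n-1}$ with $a_{(n)}\in\mathrm{End}(V)$; all its modes are assumed to have the same parity, which is the parity of $a(z)$. It is a field if $a(z)v\in V[[z]][z^{-1}]$ for all $v\in V$. A pair $(a(z),b(z))$ is local if $(z-w)^N[a(z),b(w)]=0$ for some $N\ge 0$, where $[a(z),b(w)]=a(z)b(w)-p(a,b)b(w)a(z)$. A local family is a set in which all pairs are local. A vertex algebra $(V,|0\rangle,T,Y)$ consists of a superspace $V$, a vector $|0\rangle\in V_{\bar 0}$, an even endomorphism $T$ of $V$, and a linear parity-preserving map $Y(\cdot,z)$ from $V$ to $\mathrm{End}(V)$-valued fields, $a\mapsto Y(a,z)=\sum_n a_{(n)}z^{-n-1}$, such that: (vacuum) $Y(|0\rangle,z)=\mathrm{Id}_V$,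 $Y(a,z)|0\rangle\in a+zV[[z]]$, $T|0\rangle=0$; (translation covariance) $[T,Y(a,z)]=\partial_zY(a,z)$; (locality) $\{Y(a,z)\mid a\in V\}$ is a local family. *)

(* Defs.v *)
From mathcomp Require Export all_boot all_order all_algebra.
From mathcomp Require Export reals.
From mathcomp Require Export complex.

Set Implicit Arguments.
Unset Strict Implicit.
Unset Printing Implicit Defensive.

Import Order.TTheory GRing.Theory Num.Theory.
Local Open Scope ring_scope.

(* The decomposition V = V_0 (+) V_1 is given by its two complementary
   projections.  Parities are booleans: false is even, true is odd, and
   addition of parities is exclusive or, written (+). *)
Record superspace (K : fieldType) := Superspace {
  ss_sort :> lmodType K;
  ss_proj : bool -> {linear ss_sort -> ss_sort};
  ss_projK : forall p q v,
    ss_proj p (ss_proj q v) = if p == q then ss_proj q v else 0;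
  ss_projD : forall v, v = ss_proj false v + ss_proj true v
}.

Definition of_parity (K : fieldType) (V : superspace K) (p : bool) (v : V) :=
  ss_proj V p v = v.

Section Distributions.
Variables (K : fieldType) (V : superspace K).

Definition op_parity (p : bool) (f : V -> V) :=
  forall q v, of_parity q v -> of_parity (p (+) q) (f v).

Definition op_part (p : bool) (f : V -> V) (v : V) : V :=
  \sum_(q : bool) ss_proj V (p (+) q) (f (ss_proj V q v)).

(* [f, g] = f g - (-1)^(p(f) p(g)) g f, extended bilinearly from homogeneous
   endomorphisms to all of them; see superbracket_homog. *)
Definition superbracket (f g : V -> V) (v : V) : V :=
  \sum_(p : bool) \sum_(q : bool)
    (op_part p f (op_part q g v)
     - (-1) ^+ (p && q) *: op_part q g (op_part p f v)).

(* A n is the mode a_(n), that is, the coefficient of z^(-n-1) in a(z). *)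
Definition fdist := int -> {linear V -> V}.

Definition homog_field (p : bool) (A : fdist) :=
  (forall n, op_parity p (A n)) /\
  (forall v, exists N : int, forall n, N <= n -> A n v = 0).

(* The fields form a superspace: a field is the sum of an even and an odd one.
   Mixed parities are needed for Y(a,z) when a is not homogeneous. *)
Definition is_field (A : fdist) :=
  exists A0 A1 : fdist, [/\ homog_field false A0, homog_field true A1
    & forall n v, A n v = A0 n v + A1 n v].

(* F m n is the coefficient of z^(-m-1) w^(-n-1). *)
Definition fdist2 := int -> int -> V -> V.

Definition mul_zw (F : fdist2) : fdist2 :=
  fun m n v => F (m + 1) n v - F m (n + 1) v.

Definition bracket2 (A B : fdist) : fdist2 :=
  fun m n => superbracket (A m) (B n).

Definition local_pair (A B : fdist) :=
  exists N : nat, forall m n v, iter N mul_zw (bracket2 A B) m n v = 0.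

Lemma op_part_homog (p q : bool) (f : {linear V -> V}) (v : V) :
  op_parity p f -> op_part q f v = if q == p then f v else 0.
Proof.
move=> fp; rewrite /op_part big_bool /=.
have fP r : ss_proj V (p (+) r) (f (ss_proj V r v)) = f (ss_proj V r v).
  by apply: fp; rewrite /of_parity ss_projK eqxx.
rewrite -(fP true) -(fP false) !ss_projK {fP}.
have fP r : ss_proj V (p (+) r) (f (ss_proj V r v)) = f (ss_proj V r v).
  by apply: fp; rewrite /of_parity ss_projK eqxx.
rewrite !fP; case: p q {fp fP} => [] [] /=; rewrite ?addr0 //;
  by rewrite [in RHS](ss_projD v) linearD addrC.
Qed.

Lemma superbracket_homog (p q : bool) (f g : {linear V -> V}) (v : V) :
  op_parity p f -> op_parity q g ->
  superbracket f g v = f (g v) - (-1) ^+ (p && q) *: g (f v).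
Proof.
move=> fp gq; rewrite /superbracket !big_bool /=.
rewrite !(op_part_homog _ _ fp) !(op_part_homog _ _ gq).
by case: p q {fp gq} => [] [] /=; rewrite ?linear0 ?scaler0 ?subr0 ?addr0 ?add0r.
Qed.

End Distributions.

Record vertex_algebra (K : fieldType) := VertexAlgebra {
  va_space :> superspace K;
  va_vac : va_space;
  va_T : {linear va_space -> va_space};
  va_Y : va_space -> fdist va_space;
  va_vac_even : of_parity false va_vac;
  va_T_even : op_parity false va_T;
  va_Y_linear : forall (c : K) (a b : va_space) n v,
    va_Y (c *: a + b) n v = c *: va_Y a n v + va_Y b n v;
  va_Y_field : forall p a, of_parity p a -> homog_field p (va_Y a);
  va_Y_vac : forall n v, va_Y va_vac n v = if n == -1 then v else 0;
  (* Y(a,z)|0> lies in a + z V[[z]] *)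
  va_creation : forall a, va_Y a (-1) va_vac = a;
  va_creation0 : forall a n, 0 <= n -> va_Y a n va_vac = 0;
  va_T_vac : va_T va_vac = 0;
  (* the coefficient of z^(-n-1) in d/dz Y(a,z) is - n a_(n-1) *)
  va_translation : forall a n v,
    superbracket va_T (va_Y a n) v = (- n)%:~R *: va_Y a (n - 1) v;
  va_locality : forall a b, local_pair (va_Y a) (va_Y b)
}.

(* Main.v *)
Require Import Defs.

Set Implicit Arguments.
Unset Strict Implicit.
Unset Printing Implicit Defensive.

Import Order.TTheory GRing.Theory Num.Theory.
Local Open Scope ring_scope.
Local Open Scope complex_scope.

(** This is Goddard's uniqueness argument.  The difference C(z) = B(z) - Y(b,z)
    is again local to every Y(a,w), and it kills the vacuum.  Applying
    (z-w)^N [C(z), Y(a,w)] = 0 to the vacuum therefore removes the term in which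
    C(z) acts first and leaves (z-w)^N C(z) Y(a,w)|0> = 0.  By the creation
    axiom Y(a,w)|0> is a power series in w with constant term a, so putting w = 0
    gives z^N C(z) a = 0, hence C(z) a = 0 (lemma [local_vanishing_on_vacuum]).

    The substitution w = 0 is [iter_mul_zw_w0]: among coefficients of a
    distribution without negative powers of w, multiplication by (z-w)^N acts on
    those of w^0 as multiplication by z^N.  Since neither B(z) nor b is assumed
    homogeneous, the surviving term of the bracket is a sum over parities, which
    reassembles into an ordinary composition ([superbracket_killed]). *)

Section OperatorParts.
Variables (K : fieldType) (V : superspace K).

Lemma op_part_sub (p : bool) (f g : V -> V) (v : V) :
  op_part p (f \- g) v = op_part p f v - op_part p g v.
Proof. by rewrite /op_part -sumrB; apply: eq_bigr => q _; rewrite /= linearB. Qed.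

Lemma op_partB (p : bool) (f : {linear V -> V}) (u v : V) :
  op_part p f (u - v) = op_part p f u - op_part p f v.
Proof. by rewrite /op_part -sumrB; apply: eq_bigr => q _; rewrite !linearB. Qed.

Lemma op_part0 (p : bool) (f : {linear V -> V}) : op_part p f 0 = 0.
Proof. by rewrite -[X in op_part p f X](subrr 0) op_partB subrr. Qed.

Lemma op_partD (f : {linear V -> V}) (v : V) :
  op_part false f v + op_part true f v = f v.
Proof.
rewrite /op_part !big_bool /= [in RHS](ss_projD v) linearD.
rewrite [f (ss_proj V false v) in RHS]ss_projD.
rewrite [f (ss_proj V true v) in RHS]ss_projD.
by rewrite addrACA addrC [X in _ + X = _]addrC.
Qed.

Lemma op_part_even (p : bool) (f : {linear V -> V}) (v : V) :
  of_parity false v -> op_part p f v = ss_proj V p (f v).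
Proof.
move=> v_even; rewrite /op_part big_bool /= -v_even !ss_projK /= !linear0 add0r.
by rewrite addbF.
Qed.

Lemma superbracket_subl (f f' g : {linear V -> V}) (v : V) :
  superbracket (f \- f') g v = superbracket f g v - superbracket f' g v.
Proof.
rewrite /superbracket -sumrB; apply: eq_bigr => p _.
rewrite -sumrB; apply: eq_bigr => q _.
rewrite !op_part_sub op_partB scalerBr !opprD opprK !addrA.
by congr (_ + _); rewrite addrAC.
Qed.

(** On an even vector both homogeneous parts of f vanish as soon as f does, so
    no sign survives and the parts of f and g can be summed up again. *)
Lemma superbracket_killed (f g : {linear V -> V}) (v : V) :
  of_parity false v -> f v = 0 -> superbracket f g v = f (g v).
Proof.
move=> v_even fv0; rewrite /superbracket !big_bool /=.
rewrite !(op_part_even _ f v_even) fv0 !linear0 !op_part0 !scaler0 !subr0.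
rewrite -[in RHS](op_partD g v) linearD -!(op_partD f) addrACA.
by rewrite addrC; congr (_ + _); rewrite addrC.
Qed.

End OperatorParts.

Section Locality.
Variables (K : fieldType) (V : superspace K).
Implicit Types (F G : fdist2 V) (A B C : fdist V).

Lemma iter_mul_zw_sub N F G m n v :
  iter N (@mul_zw K V) (fun m n => F m n \- G m n) m n v
  = iter N (@mul_zw K V) F m n v - iter N (@mul_zw K V) G m n v.
Proof.
elim: N m n => [//|N IHN] m n /=; rewrite /mul_zw !IHN.
by rewrite !opprD opprK !addrA; congr (_ + _); rewrite addrAC.
Qed.

Lemma iter_mul_zw_ext N F G v : (forall m n, F m n v = G m n v) ->
  forall m n, iter N (@mul_zw K V) F m n v = iter N (@mul_zw K V) G m n v.
Proof.
by move=> eqFG; elim: N => [//|N IHN] m n /=; rewrite /mul_zw !IHN.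
Qed.

Lemma iter_mul_zw_eq0 N F v : (forall m n, F m n v = 0) ->
  forall m n, iter N (@mul_zw K V) F m n v = 0.
Proof.
by move=> F0; elim: N => [//|N IHN] m n /=; rewrite /mul_zw !IHN subrr.
Qed.

(** The index n = -1 is the coefficient of w^0, and n >= 0 means a negative
    power of w.  Multiplication by w would bring the coefficient at n = 0 to
    n = -1, and that coefficient is zero. *)
Lemma iter_mul_zw_w0 N F v : (forall m n, 0 <= n -> F m n v = 0) ->
  forall m, iter N (@mul_zw K V) F m (-1) v = F (m + N%:Z) (-1) v.
Proof.
move=> F0.
have iter0 M m n : 0 <= n -> iter M (@mul_zw K V) F m n v = 0.
  elim: M m n => [|M IHM] m n n_ge0 /=; first exact: F0.
  by rewrite /mul_zw !IHM ?subrr // addr_ge0.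
elim: N => [|N IHN] m /=; first by rewrite addr0.
by rewrite /mul_zw IHN addNr iter0 // subr0 -addrA -intS.
Qed.

Lemma local_pair_sub A B C : local_pair A C -> local_pair B C ->
  local_pair (fun n => A n \- B n) C.
Proof.
move=> [N AC0] [M BC0]; exists (N + M)%N => m n v.
rewrite (@iter_mul_zw_ext _ _ (fun m n => bracket2 A C m n \- bracket2 B C m n)).
  rewrite iter_mul_zw_sub [in X in X - _]addnC !iterD.
  by rewrite !iter_mul_zw_eq0 ?subrr.
by move=> {}m {}n; apply: superbracket_subl.
Qed.

End Locality.

(** Goddard's uniqueness theorem in homogeneous form.  On the vacuum the bracket
    of C(z) with Y(a,w) is C(z) Y(a,w)|0>, which has no negative powers of w, and
    its coefficients at w^0 are those of C(z) a. *)
Lemma local_vanishing_on_vacuum (K : fieldType) (V : vertex_algebra K)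
    (C : fdist V) :
  (forall a : V, local_pair C (va_Y a)) ->
  (forall n, C n (va_vac V) = 0) ->
  forall n a, C n a = 0.
Proof.
move=> Cloc Cvac n a; have [N CY0] := Cloc a.
have CYvac i j : bracket2 C (va_Y a) i j (va_vac V) = C i (va_Y a j (va_vac V)).
  by apply: superbracket_killed => //; apply: va_vac_even.
have := CY0 (n - N%:Z) (-1) (va_vac V); rewrite iter_mul_zw_w0.
  (* Evaluating at n - N cancels the shift by N coming from z^N. *)
  by rewrite subrK CYvac va_creation.
by move=> i j j_ge0; rewrite CYvac va_creation0 // linear0.
Qed.

Theorem theorem4p3p4 (R : realType) (V : vertex_algebra R[i]) (b : V)
    (B : fdist V) :
  is_field B ->
  (forall a : V, local_pair B (va_Y a)) ->
  (forall n : int, B n (va_vac V) = va_Y b n (va_vac V)) ->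
  forall n : int, B n =1 va_Y b n.
Proof.
move=> _ Bloc Bvac n a; apply/eqP; rewrite -subr_eq0; apply/eqP.
apply: (@local_vanishing_on_vacuum _ V (fun n => B n \- va_Y b n)) => [c|i] /=.
  exact: local_pair_sub (Bloc c) (va_locality b c).
by rewrite Bvac subrr.
Qed.
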